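(* Let $K_1,K_2\in\mathcal L(\mathcal H)$ and let $\mathcal W=\{(W_i,w_i)\}_{i\in I}$ be both a $K_1$-fusion frame and a $K_2$-fusion frame for $\mathcal H$. Then for any $\alpha,\beta\in\mathbb R$, $\mathcal W$ is an $(\alpha K_1+\beta K_2)$-fusion frame for $\mathcal H$, and $\mathcal W$ is a $(K_1K_2)$-fusion frame for $\mathcal H$.
   Context: $\mathcal H$ is a separable Hilbert space, $\mathcal L(\mathcal H)$ is the space of bounded linear operators on $\mathcal H$, and $I$ is a countable index set. For a closed subspace $W$, $\pi_W$ denotes the orthogonal projection onto $W$. Let $\{W_i\}_{i\in I}$ be a sequence of closed subspaces of $\mathcal H$, $\{w_i\}_{i\in I}$ a family of weights ($w_i>0$ for all $i$), and $K\in\mathcal L(\mathcal H)$. Then $\{(W_i,w_i)\}_{i\in I}$ is a $K$-fusion frame for $\mathcal H$ if there exist constants $0<A\le B<\infty$ such that $A\|K^*f\|^2\le\sum_{i\in I}w_i^2\|\pi_{W_i}(f)\|^2\le B\|f\|^2$ for all $f\in\mathcal H$. *)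

(* Defs.v *)
From HB Require Import structures.
From mathcomp Require Import all_boot all_order all_algebra.
From mathcomp Require Import sesquilinear.
From mathcomp Require Import complex.
From mathcomp Require Import all_classical all_reals all_analysis.

Set Implicit Arguments.
Unset Strict Implicit.
Unset Printing Implicit Defensive.

Import Order.TTheory GRing.Theory Num.Theory.
Import numFieldNormedType.Exports.

Local Open Scope classical_set_scope.
Local Open Scope ring_scope.
Local Open Scope complex_scope.

(* A Hilbert space is real or complex; [k] selects the scalar field, and
   [scalar_conj], [scalar_re] and [scalar_of_real] are the conjugation, the real
   part and the embedding of the reals for that field. *)
Variant scalar_kind := RealScalars | ComplexScalars.

Definition scalar_field (R : realType) (k : scalar_kind) : numFieldType :=
  match k with
  | RealScalars => R
  | ComplexScalars => R[i]
  end.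

Definition scalar_conj (R : realType) (k : scalar_kind) :
    scalar_field R k -> scalar_field R k :=
  match k return scalar_field R k -> scalar_field R k with
  | RealScalars => fun a => a
  | ComplexScalars => fun a : R[i] => a^*%C
  end.

Definition scalar_re (R : realType) (k : scalar_kind) : scalar_field R k -> R :=
  match k return scalar_field R k -> R with
  | RealScalars => fun a => a
  | ComplexScalars => fun a : R[i] => complex.Re a
  end.

Definition scalar_of_real (R : realType) (k : scalar_kind) : R -> scalar_field R k :=
  match k return R -> scalar_field R k with
  | RealScalars => fun a => a
  | ComplexScalars => fun a => a%:C
  end.

Definition separable_space (T : topologicalType) : Prop :=
  exists S : set T, countable S /\ dense S.

Section Hilbert.
Context {R : realType} {k : scalar_kind}.
Context {H : completeNormedModType (scalar_field R k)}.
Implicit Type ip : {dot H for @scalar_conj R k}.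

(* [ip] is linear in its first argument and conjugate-linear in the second.
   A Hilbert space is a complete normed module together with such a form that
   induces its norm. *)
Definition induces_norm ip : Prop := forall x : H, `|x| ^+ 2 = ip x x.

(* The norm of a [normedModType F] has values in [F]; this is the same norm with
   values in [R]. *)
Definition rnorm (x : H) : R := scalar_re `|x|.

Definition bounded_operator (K : {linear H -> H}) : Prop :=
  exists M : R, forall x : H, rnorm (K x) <= M * rnorm x.

Definition closed_subspace (W : set H) : Prop :=
  [/\ W 0,
      forall (a : scalar_field R k) (x y : H), W x -> W y -> W (a *: x + y) &
      closed W].

(* [adjoint ip K] is K^*: [adjoint ip K y] is the (unique) vector representing the functional
   [fun x => ip (K x) y]; 0 if there is none. *)
Definition adjoint ip (K : {linear H -> H}) (y : H) : H :=
  xget 0 [set z | forall x, ip (K x) y = ip x z].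

(* [orthoproj ip W x] is the (unique) [y] in [W] with [x - y] orthogonal to [W];
   0 if there is none. *)
Definition orthoproj ip (W : set H) (x : H) : H :=
  xget 0 [set y | W y /\ forall z, W z -> ip (x - y) z = 0].

(* The sum is taken in the extended reals, so its finiteness is part of the
   upper inequality. *)
Definition K_fusion_frame ip (K : {linear H -> H}) (I : countType)
    (W : I -> set H) (w : I -> R) : Prop :=
  [/\ bounded_operator K,
      forall i, closed_subspace (W i),
      forall i, 0 < w i &
      exists A B : R, [/\ 0 < A, A <= B &
        forall f : H,
          let S := \esum_(i in [set: I])
                     (w i ^+ 2 * rnorm (orthoproj ip (W i) f) ^+ 2)%:E in
          ((A * rnorm (adjoint ip K f) ^+ 2)%:E <= S)%E /\
          (S <= (B * rnorm f ^+ 2)%:E)%E]].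

End Hilbert.

(* Main.v *)
Require Import Defs.
From HB Require Import structures.
From mathcomp Require Import all_boot all_order all_algebra.
From mathcomp Require Import sesquilinear complex.
From mathcomp Require Import all_classical all_reals all_analysis.
From mathcomp Require Import ring lra.

Import Order.TTheory GRing.Theory Num.Theory.
Import numFieldNormedType.Exports.

Local Open Scope ring_scope.

(** Write [S f] for the frame sum of [f].  The upper frame inequality does not
    mention the operator, so only the lower one has to be established.

    - [adjoint_lincomb]: the adjoint of [alpha K1 + beta K2] is
      [alpha K1^* + beta K2^*], whence
      [|(alpha K1 + beta K2)^* f| <= |alpha| |K1^* f| + |beta| |K2^* f|].
    - [adjoint_comp], [rnorm_adjoint_le]: the adjoint of [K1 K2] is
      [K2^* K1^*], and [K2^*] inherits every bound of [K2], whence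
      [|(K1 K2)^* f| <= M |K1^* f|] whenever [|K2 x| <= M |x|] for all [x].

    In both cases [|K^* f| <= C1 |K1^* f| + C2 |K2^* f|].  By
    [K_fusion_frame_dominated], squaring this and using
    [A1 |K1^* f|^2 <= S f] and [A2 |K2^* f|^2 <= S f] bounds [|K^* f|^2] by a
    multiple of [S f].

    Since [adjoint] takes the value 0 where no representing vector exists, these
    identities depend on every bounded operator having an adjoint
    ([adjointP]), that is, on the Riesz theorem [riesz_representation].  The
    latter is proved by minimising [|x|^2 - 2 Re (phi x)]: the parallelogram law
    makes minimising sequences Cauchy, and the first variation of the functional
    at their limit vanishes ([real_riesz]). *)

(** * Real or complex scalars *)

Section Scalars.
Context {R : realType} {k : scalar_kind}.
Implicit Types a b : scalar_field R k.

Lemma scalar_reD a b : scalar_re (a + b) = scalar_re a + scalar_re b.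
Proof. by case: k a b => //= -[? ?] [? ?]. Qed.

Lemma scalar_reN a : scalar_re (- a) = - scalar_re a.
Proof. by case: k a => //= -[]. Qed.

Lemma scalar_re_conj a : scalar_re (scalar_conj a) = scalar_re a.
Proof. by case: k a => //= -[]. Qed.

Lemma scalar_conj_real (c : R) :
  scalar_conj (scalar_of_real k c) = scalar_of_real k c.
Proof. by case: k => //=; rewrite /conjc /= oppr0. Qed.

Lemma scalar_reZ (c : R) a :
  scalar_re (scalar_of_real k c * a) = c * scalar_re a.
Proof. by case: k a => //= -[? ?] /=; rewrite mul0r subr0. Qed.

Lemma scalar_re_real (c : R) : scalar_re (scalar_of_real k c) = c.
Proof. by case: k. Qed.

Lemma scalar_of_real_re a : 0 <= a -> scalar_of_real k (scalar_re a) = a.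
Proof.
by case: k a => //= -[x y]; rewrite lecE /= => /andP[/eqP -> _].
Qed.

Lemma ler_scalar_of_real (c d : R) :
  (scalar_of_real k c <= scalar_of_real k d) = (c <= d).
Proof. by case: k => //=; rewrite lecR. Qed.

Lemma ltr_scalar_of_real (c d : R) :
  (scalar_of_real k c < scalar_of_real k d) = (c < d).
Proof. by case: k => //=; rewrite ltcR. Qed.

Lemma scalar_of_real0 : scalar_of_real k (0 : R) = 0.
Proof. by case: k. Qed.

Lemma scalar_of_realM (c d : R) :
  scalar_of_real k (c * d) = scalar_of_real k c * scalar_of_real k d.
Proof. by case: k => //=; rewrite rmorphM. Qed.

Lemma scalar_of_real_norm (c : R) :
  `|scalar_of_real k c| = scalar_of_real k `|c|.
Proof. by case: k => //=; rewrite normc_def /= expr0n addr0 sqrtr_sqr. Qed.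

(** A scalar [a] is determined by the real parts of its multiples: multiplying
    by the imaginary unit exchanges real and imaginary parts up to sign. *)
Lemma scalar_re_inj a b :
  (forall c, scalar_re (c * a) = scalar_re (c * b)) -> a = b.
Proof.
case: k a b => /= [a b /(_ 1)|[a1 a2] [b1 b2] e]; first by rewrite !mul1r.
move: (e 1) (e 'i%C) => /=; rewrite !mul0r !mul1r !subr0 !sub0r.
by move=> -> /oppr_inj ->.
Qed.

End Scalars.

(** * Inner product and norm *)

Section InnerProduct.
Local Open Scope classical_set_scope.
Context {R : realType} {k : scalar_kind}.
Context {H : completeNormedModType (scalar_field R k)}.
Context (ip : {dot H for @scalar_conj R k}).

(** The real part of the inner product: a real inner product that induces the
    same norm. *)
Definition rip (x y : H) : R := scalar_re (ip x y).

Lemma ip_scale_right (a : scalar_field R k) (x y : H) :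
  ip x (a *: y) = scalar_conj a * ip x y.
Proof. by rewrite linearZr_LR. Qed.

Lemma ip_scale_left (a : scalar_field R k) (x y : H) :
  ip (a *: x) y = a * ip x y.
Proof. by rewrite linearZl_LR. Qed.

Lemma ripC (x y : H) : rip x y = rip y x.
Proof.
by rewrite /rip (hermitian_subproof x y) expr0 mul1r scalar_re_conj.
Qed.

Lemma ripDl (x y z : H) : rip (x + y) z = rip x z + rip y z.
Proof. by rewrite /rip linearDl scalar_reD. Qed.

Lemma ripNl (x z : H) : rip (- x) z = - rip x z.
Proof. by rewrite /rip linearNl scalar_reN. Qed.

Lemma ripBl (x y z : H) : rip (x - y) z = rip x z - rip y z.
Proof. by rewrite ripDl ripNl. Qed.

Lemma ripZl (c : R) (x z : H) : rip (scalar_of_real k c *: x) z = c * rip x z.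
Proof. by rewrite /rip ip_scale_left scalar_reZ. Qed.

Lemma normE (x : H) : `|x| = scalar_of_real k (rnorm x).
Proof. by rewrite /rnorm scalar_of_real_re. Qed.

Lemma rnorm_ge0 (x : H) : 0 <= rnorm x.
Proof. by rewrite -(ler_scalar_of_real (k := k)) -normE scalar_of_real0. Qed.

Lemma rnormN (x : H) : rnorm (- x) = rnorm x.
Proof. by rewrite /rnorm normrN. Qed.

Lemma rnorm0_eq0 (x : H) : rnorm x = 0 -> x = 0.
Proof. by move=> x0; apply/normr0_eq0; rewrite normE x0 scalar_of_real0. Qed.

Lemma rnormD (x y : H) : rnorm (x + y) <= rnorm x + rnorm y.
Proof.
have -> : rnorm x + rnorm y = scalar_re (`|x| + `|y|) by rewrite scalar_reD.
rewrite -(ler_scalar_of_real (k := k)) -normE scalar_of_real_re ?addr_ge0 //.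
exact: ler_normD.
Qed.

Lemma rnormZ (c : R) (x : H) : rnorm (scalar_of_real k c *: x) = `|c| * rnorm x.
Proof. by rewrite /rnorm normrZ scalar_of_real_norm scalar_reZ. Qed.

Hypothesis hip : induces_norm ip.

Lemma rip_diag (x : H) : rip x x = rnorm x ^+ 2.
Proof. by rewrite /rip -hip normE expr2 -scalar_of_realM scalar_re_real. Qed.

Lemma rnorm_sqrD (x y : H) :
  rnorm (x + y) ^+ 2 = rnorm x ^+ 2 + 2 * rip x y + rnorm y ^+ 2.
Proof.
rewrite -!rip_diag ripDl [rip x (x + y)]ripC [rip y (x + y)]ripC !ripDl.
by rewrite [rip y x]ripC; ring.
Qed.

Lemma cauchy_schwarz (x y : H) : `|rip x y| <= rnorm x * rnorm y.
Proof.
have half (u v : H) : rip u v <= rnorm u * rnorm v.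
  have [u0|un0] := eqVneq (rnorm u) 0.
    by rewrite u0 (rnorm0_eq0 _ u0) mul0r /rip linear0l; case: (k).
  have [v0|vn0] := eqVneq (rnorm v) 0.
    by rewrite v0 (rnorm0_eq0 _ v0) mulr0 ripC /rip linear0l; case: (k).
  have up : 0 < rnorm u by rewrite lt0r un0 rnorm_ge0.
  have vp : 0 < rnorm v by rewrite lt0r vn0 rnorm_ge0.
  (* [|(|v| u - |u| v)|^2] is [2 |u| |v|] times [|u| |v| - rip u v]. *)
  have := sqr_ge0 (rnorm (scalar_of_real k (rnorm v) *: u
                          + scalar_of_real k (- rnorm u) *: v)).
  rewrite rnorm_sqrD !rnormZ normrN !ger0_norm ?rnorm_ge0 //.
  rewrite ripZl ripC ripZl ripC.
  move=> h; rewrite -subr_ge0 -(pmulr_rge0 _ (mulr_gt0 up vp)).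
  by move: h; nra.
rewrite ler_norml half andbT lerNl -ripNl.
by rewrite (le_trans (half _ _)) ?rnormN.
Qed.

(** Completeness of [H], expressed with the real-valued norm. *)
Lemma complete_rnorm (u : nat -> H) :
  (forall e : R, 0 < e ->
    exists N, forall n, (N <= n)%N -> rnorm (u N - u n) < e) ->
  exists l, forall e : R, 0 < e ->
    exists N, forall n, (N <= n)%N -> rnorm (l - u n) < e.
Proof.
move=> cauchy_u.
have gt0_real (e : scalar_field R k) : 0 < e ->
    exists2 d : R, 0 < d & e = scalar_of_real k d.
  move=> e0; exists (scalar_re e); last by rewrite scalar_of_real_re // ltW.
  rewrite -(ltr_scalar_of_real (k := k)).
  by rewrite scalar_of_real_re ?ltW ?scalar_of_real0.
have /cauchy_cvg cu : cauchy (u @ \oo).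
  apply: cauchy_exP => e /gt0_real[d d0 ->].
  have [N uN] := cauchy_u _ d0; exists (u N), N => // n /= Nn.
  by rewrite -ball_normE /= normE ltr_scalar_of_real uN.
exists (lim (u @ \oo)) => e e0.
have /cvgrPdist_lt/(_ (scalar_of_real k e)) := cu.
rewrite -[X in X < _]scalar_of_real0 ltr_scalar_of_real => /(_ e0)[N _ uN].
by exists N => n /uN /=; rewrite normE ltr_scalar_of_real.
Qed.

(** * Riesz representation *)

(** Riesz representation for the underlying real inner product.  The vector
    minimising [|x|^2 - 2 phi x] represents [phi]. *)
Lemma real_riesz (phi : H -> R) (M : R) :
  (forall x y, phi (x + y) = phi x + phi y) ->
  (forall (c : R) x, phi (scalar_of_real k c *: x) = c * phi x) ->
  (forall x, `|phi x| <= M * rnorm x) ->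
  exists z, forall x, phi x = rip x z.
Proof.
move=> phiD phiZ phi_bnd.
pose q x := rnorm x ^+ 2 - 2 * phi x.
have q_lb x : - M ^+ 2 <= q x.
  have := phi_bnd x; rewrite ler_norml /q => /andP[_].
  by have := sqr_ge0 (rnorm x - M); nra.
pose E : set R := range q.
have infE : has_inf E.
  by split; [exists (q 0), 0|exists (- M ^+ 2) => _ [x _ <-]].
pose d := inf E.
have d_le x : d <= q x by apply: ge_inf; [exact: infE.2|exists x].
have /choice[z zP] (n : nat) : exists x, q x < d + n.+1%:R^-1.
  have n0 : 0 < n.+1%:R^-1 :> R by rewrite invr_gt0 ltr0n.
  have [_ [x _ <-] xd] := inf_adherent n0 infE.
  by exists x.
have inv_small (e : R) : 0 < e ->
    exists N, forall n, (N <= n)%N -> n.+1%:R^-1 < e.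
  move=> e0; exists (Num.truncn e^-1) => n Nn.
  rewrite invf_plt ?posrE ?ltr0n //.
  by rewrite (lt_le_trans (truncnS_gt _)) ?ler_nat.
(* Parallelogram law: near-minimisers are close to one another. *)
have close x y e :
    q x < d + e -> q y < d + e -> rnorm (x - y) ^+ 2 <= 4 * e.
  have := d_le (scalar_of_real k (2^-1) *: (x + y)).
  rewrite /q rnormZ exprMn phiZ phiD rnorm_sqrD rnorm_sqrD.
  rewrite [rip x (- y)]ripC ripNl [rip y x]ripC.
  rewrite rnormN ger0_norm ?invr_ge0 ?ler0n //.
  lra.
have [l lP] : exists l, forall e : R, 0 < e ->
    exists N, forall n, (N <= n)%N -> rnorm (l - z n) < e.
  apply: complete_rnorm => e e0.
  (* Any multiple of [e^2] below [e^2 / 4] would do. *)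
  have [N NP] := inv_small (e ^+ 2 / 5) ltac:(by rewrite divr_gt0 ?exprn_gt0).
  exists N => n Nn.
  have := close (z N) (z n) (e ^+ 2 / 5).
  move/(_ (lt_trans (zP _) _))/(_ (lt_trans (zP _) _)).
  rewrite !ltrD2l => /(_ (NP _ (leqnn _)) (NP _ Nn)) h.
  rewrite -(ltr_pXn2r (n := 2)) ?nnegrE ?rnorm_ge0 ?(ltW e0) //.
  apply: le_lt_trans h _.
  have : 0 < e ^+ 2 by rewrite exprn_gt0.
  lra.
exists l => x; apply/eqP; rewrite eq_sym -subr_eq0; apply/eqP.
set r := _ - _.
(* [q] decreases by less than [e / 2] from [z n] to [z n + t x]; replacing
   [rip (z n) x] by [rip l x] costs another [e / 2], for [n] large. *)
have variation (t : R) : 0 <= 2 * t * r + t ^+ 2 * rnorm x ^+ 2.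
  suff approx (e : R) : 0 < e -> - (2 * t * r + t ^+ 2 * rnorm x ^+ 2) <= e.
    by rewrite -oppr_le0; apply/ler_addgt0Pl => e /approx; rewrite addr0.
  move=> e0.
  have s0 : 0 < 2 * `|t| * rnorm x + 1.
    by rewrite ltr_wpDl // !mulr_ge0 ?rnorm_ge0.
  have [N1 N1P] := inv_small (e / 2) ltac:(by rewrite divr_gt0).
  have [N2 N2P] := lP (e / 2 / (2 * `|t| * rnorm x + 1))
    ltac:(by rewrite !divr_gt0).
  pose n := maxn N1 N2.
  have := N1P n (leq_maxl _ _); have := N2P n (leq_maxr _ _).
  rewrite ltr_pdivlMr // => n2 n1.
  have := d_le (z n + scalar_of_real k t *: x); have := zP n.
  rewrite /q rnorm_sqrD phiD phiZ [rip (z n) _]ripC ripZl rnormZ.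
  rewrite exprMn real_normK ?num_real//.
  have cs : `|t * rip x (l - z n)| <= `|t| * (rnorm x * rnorm (l - z n)).
    by rewrite normrM ler_wpM2l // cauchy_schwarz.
  move: cs; rewrite [rip x (_ - _)]ripC ripBl ![rip _ x]ripC ler_norml /r.
  move=> /andP[c1 c2] q1 q2.
  have := rnorm_ge0 (l - z n).
  move: (n.+1%:R^-1) n1 q1 => en n1 q1.
  lra.
(* A quadratic [2 t r + t^2 |x|^2] that is nonnegative for all [t] has [r = 0];
   the denominator [|x|^2 + 1] also covers [x = 0]. *)
have := variation (- r / (rnorm x ^+ 2 + 1)).
have x0 : 0 < rnorm x ^+ 2 + 1 by rewrite ltr_wpDl ?sqr_ge0.
have -> : 2 * (- r / (rnorm x ^+ 2 + 1)) * r
   + (- r / (rnorm x ^+ 2 + 1)) ^+ 2 * rnorm x ^+ 2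
   = - ((r / (rnorm x ^+ 2 + 1)) ^+ 2 * (rnorm x ^+ 2 + 2)).
  by field; rewrite gt_eqF.
rewrite oppr_ge0 pmulr_lle0; last by rewrite ltr_wpDl ?sqr_ge0.
move=> h; have /eqP := le_anti (introT andP (conj h (sqr_ge0 _))).
by rewrite sqrf_eq0 mulf_eq0 invr_eq0 [_ + 1 == 0]gt_eqF // orbF => /eqP.
Qed.

(** Riesz representation theorem, over the reals or the complex numbers.
    Bounding the real part of [phi] is enough, and is equivalent by linearity. *)
Theorem riesz_representation (phi : H -> scalar_field R k) (M : R) :
  (forall a x y, phi (a *: x + y) = a * phi x + phi y) ->
  (forall x, `|scalar_re (phi x)| <= M * rnorm x) ->
  exists z, forall x, phi x = ip x z.
Proof.
move=> phiL phi_bnd.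
have phi0 : phi 0 = 0.
  have := phiL 1 0 0; rewrite scale1r mul1r addr0 => /eqP.
  by rewrite eq_sym -subr_eq0 addrK => /eqP.
have phiZ a x : phi (a *: x) = a * phi x.
  by rewrite -[a *: x]addr0 phiL phi0 addr0.
have [||z zP] := @real_riesz (fun x => scalar_re (phi x)) M _ _ phi_bnd.
- by move=> x y; rewrite -[x]scale1r phiL mul1r scale1r scalar_reD.
- by move=> c x; rewrite phiZ scalar_reZ.
exists z => x; apply: scalar_re_inj => c.
by rewrite -phiZ zP /rip ip_scale_left.
Qed.

(** * Adjoints of bounded operators *)

Lemma bounded_operator_nneg (K : {linear H -> H}) : bounded_operator K ->
  exists2 M : R, 0 <= M & forall x, rnorm (K x) <= M * rnorm x.
Proof.
move=> [M KM]; exists `|M| => // x; apply: le_trans (KM x) _.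
by rewrite ler_wpM2r ?rnorm_ge0 ?ler_norm.
Qed.

Lemma ip_inj (y z : H) : (forall x, ip x y = ip x z) -> y = z.
Proof.
move=> e; apply/subr0_eq/rnorm0_eq0/eqP; rewrite -(sqrf_eq0 (rnorm _)).
by rewrite -rip_diag ripBl [rip y _]ripC [rip z _]ripC /rip e subrr.
Qed.

Lemma adjointP (K : {linear H -> H}) : bounded_operator K ->
  forall x y, ip (K x) y = ip x (adjoint ip K y).
Proof.
move=> /bounded_operator_nneg[M M0 KM] x y.
have [||z zP] := @riesz_representation (fun x => ip (K x) y) (M * rnorm y).
- by move=> a u v; rewrite linearP linearDl /= ip_scale_left.
- move=> u; apply: le_trans (cauchy_schwarz _ _) _.
  by rewrite mulrAC ler_wpM2r ?rnorm_ge0.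
have := @xgetI _ 0 [set z | forall x, ip (K x) y = ip x z] z zP.
exact.
Qed.

Lemma adjoint_unique (K : {linear H -> H}) (y z : H) : bounded_operator K ->
  (forall x, ip (K x) y = ip x z) -> adjoint ip K y = z.
Proof. by move=> bK zP; apply: ip_inj => x; rewrite -adjointP. Qed.

Lemma rnorm_adjoint_le (K : {linear H -> H}) (M : R) : bounded_operator K ->
  (forall x, rnorm (K x) <= M * rnorm x) ->
  forall y, rnorm (adjoint ip K y) <= M * rnorm y.
Proof.
move=> bK KM y; set z := adjoint ip K y.
have [z0|zn0] := eqVneq (rnorm z) 0.
  rewrite z0; have [y0|yn0] := eqVneq (rnorm y) 0; first by rewrite y0 mulr0.
  by rewrite (le_trans (rnorm_ge0 (K y))).
have zp : 0 < rnorm z by rewrite lt0r zn0 rnorm_ge0.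
(* [|z|^2 = <z, K^* y> = <K z, y>] *)
rewrite -(ler_pM2l zp) -expr2 -rip_diag {2}/z /rip -adjointP //.
apply: le_trans (ler_norm _) (le_trans (cauchy_schwarz _ _) _).
by rewrite mulrCA mulrA ler_wpM2r ?rnorm_ge0.
Qed.

Section LinearCombination.
Variables (K1 K2 : {linear H -> H}) (alpha beta : R).
Hypotheses (bK1 : bounded_operator K1) (bK2 : bounded_operator K2).

Let K : {linear H -> H} :=
  (scalar_of_real k alpha \*: K1) \+ (scalar_of_real k beta \*: K2).

Lemma bounded_operator_lincomb : bounded_operator K.
Proof.
have [M1 M10 K1M] := bounded_operator_nneg _ bK1.
have [M2 M20 K2M] := bounded_operator_nneg _ bK2.
exists (`|alpha| * M1 + `|beta| * M2) => x /=.
apply: le_trans (rnormD _ _) _; rewrite !rnormZ mulrDl -!mulrA.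
by rewrite lerD ?ler_wpM2l.
Qed.

Lemma adjoint_lincomb (f : H) :
  adjoint ip K f = scalar_of_real k alpha *: adjoint ip K1 f
                   + scalar_of_real k beta *: adjoint ip K2 f.
Proof.
apply: (adjoint_unique _ _ _ bounded_operator_lincomb) => x /=.
rewrite linearDl linearDr /= !ip_scale_left !ip_scale_right !scalar_conj_real.
by rewrite !adjointP.
Qed.

End LinearCombination.

Section Composition.
Variables (K1 K2 : {linear H -> H}).
Hypotheses (bK1 : bounded_operator K1) (bK2 : bounded_operator K2).

Lemma bounded_operator_comp : bounded_operator (K1 \o K2).
Proof.
have [M1 M10 K1M] := bounded_operator_nneg _ bK1.
have [M2 M20 K2M] := bounded_operator_nneg _ bK2.
exists (M1 * M2) => x /=; apply: le_trans (K1M _) _.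
by rewrite -mulrA ler_wpM2l.
Qed.

Lemma adjoint_comp (f : H) :
  adjoint ip (K1 \o K2) f = adjoint ip K2 (adjoint ip K1 f).
Proof.
apply: (adjoint_unique _ _ _ bounded_operator_comp) => x /=.
by rewrite !adjointP.
Qed.

End Composition.

(** * Fusion frames *)

(** If [|K^* f|] is controlled by [|K1^* f|] and [|K2^* f|], then the lower
    frame inequalities for [K1] and [K2] give one for [K]. *)
Lemma K_fusion_frame_dominated (I : countType) (W : I -> set H) (w : I -> R)
    (K1 K2 K : {linear H -> H}) (C1 C2 : R) :
  K_fusion_frame ip K1 W w -> K_fusion_frame ip K2 W w ->
  bounded_operator K ->
  (forall f, rnorm (adjoint ip K f)
             <= C1 * rnorm (adjoint ip K1 f) + C2 * rnorm (adjoint ip K2 f)) ->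
  K_fusion_frame ip K W w.
Proof.
move=> [_ cW w0 [A1 [B [A10 A1B F1]]]] [_ _ _ [A2 [B2 [A20 _ F2]]]] bK dom.
have B0 : 0 < B by exact: lt_le_trans A1B.
(* The summand [B^-1] makes the new lower bound at most [B]. *)
pose D := 2 * C1 ^+ 2 / A1 + 2 * C2 ^+ 2 / A2 + B^-1.
have D1 : 0 <= 2 * C1 ^+ 2 / A1.
  by rewrite divr_ge0 ?(ltW A10) ?(ltW A20) // mulr_ge0 ?sqr_ge0.
have D2 : 0 <= 2 * C2 ^+ 2 / A2.
  by rewrite divr_ge0 ?(ltW A10) ?(ltW A20) // mulr_ge0 ?sqr_ge0.
have DB : B^-1 <= D by rewrite lerDr addr_ge0.
have D0 : 0 < D by apply: lt_le_trans DB; rewrite invr_gt0.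
split=> //; exists D^-1, B; split; rewrite ?invr_gt0 //.
  by rewrite invf_ple ?posrE.
move=> f S; have [l1 u] := F1 f; have [l2 _] := F2 f; split=> //.
move: l1 l2 u; rewrite -/S; move: S => {F1 F2} [s| |] //=.
rewrite !lee_fin => l1 l2 _.
rewrite mulrC ler_pdivrMr // /D.
set a := rnorm (adjoint ip K1 f) in l1 *.
set b := rnorm (adjoint ip K2 f) in l2 *.
have s0 : 0 <= s by apply: le_trans l1; rewrite mulr_ge0 ?sqr_ge0 ?(ltW A10).
have a_le : C1 ^+ 2 * a ^+ 2 <= s * (C1 ^+ 2 / A1).
  by rewrite [s * _]mulrCA ler_wpM2l ?sqr_ge0 // ler_pdivlMr // mulrC.
have b_le : C2 ^+ 2 * b ^+ 2 <= s * (C2 ^+ 2 / A2).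
  by rewrite [s * _]mulrCA ler_wpM2l ?sqr_ge0 // ler_pdivlMr // mulrC.
have sB : 0 <= s / B by rewrite divr_ge0 ?(ltW B0).
have dsq : rnorm (adjoint ip K f) ^+ 2 <= (C1 * a + C2 * b) ^+ 2.
  by rewrite ler_pXn2r ?nnegrE ?rnorm_ge0 ?(le_trans (rnorm_ge0 _) (dom f)).
have diff2 := sqr_ge0 (C1 * a - C2 * b).
apply: (le_trans dsq); rewrite -!mulrA !mulrDr ![s * (2 * _)]mulrCA.
by lra.
Qed.

End InnerProduct.

Theorem theorem7 (R : realType) (k : scalar_kind)
    (H : completeNormedModType (scalar_field R k))
    (ip : {dot H for @scalar_conj R k})
    (hip : induces_norm ip)
    (hsep : separable_space H)
    (I : countType) (W : I -> set H) (w : I -> R)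
    (K1 K2 : {linear H -> H})
    (hf1 : K_fusion_frame ip K1 W w)
    (hf2 : K_fusion_frame ip K2 W w) :
  (forall alpha beta : R,
     K_fusion_frame ip
       ((scalar_of_real k alpha \*: K1) \+ (scalar_of_real k beta \*: K2)) W w)
  /\ K_fusion_frame ip (K1 \o K2) W w.
Proof.
have [bK1 _ _ _] := hf1; have [bK2 _ _ _] := hf2; split=> [alpha beta|].
- apply: (@K_fusion_frame_dominated
    _ _ _ _ _ _ _ K1 K2 _ `|alpha| `|beta|) => //.
    exact: bounded_operator_lincomb.
  by move=> f; rewrite adjoint_lincomb // (le_trans (rnormD _ _)) ?rnormZ.
- have [M _ K2M] := bounded_operator_nneg _ bK2.
  apply: (@K_fusion_frame_dominated _ _ _ _ _ _ _ K1 K2 _ M 0) => //.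
    exact: bounded_operator_comp.
  by move=> f; rewrite adjoint_comp // mul0r addr0; apply: rnorm_adjoint_le.
Qed.
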